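(* Let $\mathcal S=\Phi(\Omega)$ be an $\mathbb H^1$-regular surface represented as an $X$-graph of a continuous function $\phi:\Omega\to\mathbb R$ (with $f,\phi,\Phi,w,W^\phi$ as in the context). Let $\gamma:I_\gamma\to\Omega$ be any (maximal) solution of the Cauchy problem $\gamma'(t)=W^\phi(\gamma(t))$, $\gamma(0)=(y_0,z_0)\in\Omega$. Then $\gamma$ is of class $C^2$, or equivalently $\phi\circ\gamma$ is of class $C^1$, and hence $\Phi\circ\gamma$ is a horizontal curve of class $C^1$ on $\mathcal S$. Moreover, for every $t\in I_\gamma$, $$(\phi\circ\gamma)'(t)=w(\gamma(t)),\qquad (\Phi\circ\gamma)'(t)=\Big(-\frac{Yf}{Xf}X+Y\Big)\circ\Phi\circ\gamma(t).$$
   Context: The Heisenberg group $\mathbb H^1$ is $\mathbb R^3$ with the law $(x,y,z)(x',y',z')=(x+x',y+y',z+z'+2x'y-2xy')$, dilations $\delta_t(x,y,z)=(tx,ty,t^2z)$, and left-invariant horizontal vector fields $X=\partial_x+2y\partial_z$, $Y=\partial_y-2x\partial_z$. Put $\rho_\infty(x,y,z)=\max\{\sqrt{x^2+y^2},|z|^{1/2}\}$. A function $f:\mathbb H^1\to\mathbb R$ is of class $C^1_H$ if at every $A$ there is a continuous group homomorphism $L=D_hf(A):\mathbb H^1\to\mathbb R$ with $L(\delta_tB)=tL(B)$ and $f(AB)-f(A)-L(B)=o(\rho_\infty(B))$ as $B\to0$, depending continuously on $A$; equivalently the derivatives $Xf,Yf$ along $X,Y$ exist and are continuous. Setting: $f\in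 C^1_H(\mathbb H^1,\mathbb R)$ with $f(0)=0$ and $Xf(0)\neq0$; $U$ is a neighbourhood of $0$ on which $Xf\ne 0$, $\Omega\subset\mathbb R^2$ is open, and $\phi:\Omega\to\mathbb R$ is a continuous function such that $$\mathcal S:=f^{-1}(0)\cap U=\{\Phi(y,z):(y,z)\in\Omega\},\qquad \Phi(y,z):=(0,y,z)(\phi(y,z),0,0)=(\phi(y,z),\,y,\,z+2\phi(y,z)y),$$ $\Phi$ being a homeomorphism of $\Omega$ onto $\mathcal S$ (such a representation is given by the implicit function theorem). Notation: $w=-\frac{Yf}{Xf}\circ\Phi$, and $W^\phi(y,z)=\partial_y-4\phi(y,z)\partial_z$, a continuous vector field on $\Omega$. The solution $\gamma$ is a $C^1$ curve on a maximal open interval $I_\gamma\ni0$; it need not be unique. A $C^1$ curve in $\mathbb H^1$ is horizontal if its velocity lies everywhere in the span of $X,Y$. *)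

(* Defs.v *)
From Stdlib Require Import Reals.
From Coquelicot Require Import Coquelicot.
Open Scope R_scope.

(* A point (x, y, z) of the Heisenberg group is the triple ((x, y), z). *)
Notation H1 := (prod (prod R R) R).

Definition hmul (A B : H1) : H1 :=
  let '(x, y, z) := A in
  let '(x', y', z') := B in
  (x + x', y + y', z + z' + 2 * x' * y - 2 * x * y').

Definition dil (t : R) (A : H1) : H1 :=
  let '(x, y, z) := A in (t * x, t * y, t ^ 2 * z).

Definition rho_inf (A : H1) : R :=
  let '(x, y, z) := A in Rmax (sqrt (x ^ 2 + y ^ 2)) (sqrt (Rabs z)).

(* Vector fields are given by their components in the coordinate frame. *)
Definition vX (A : H1) : H1 := let '(x, y, z) := A in (1, 0, 2 * y).
Definition vY (A : H1) : H1 := let '(x, y, z) := A in (0, 1, - 2 * x).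

(* Derivative of f along V, computed along the line s |-> A + s V(A). For
   V = X, Y this line is the integral curve of V through A, by [vX_flow] and
   [vY_flow], so no Euclidean differentiability of f is involved. [Derive] is
   total; for f of class C^1_H the derivatives along X and Y exist. *)
Definition derive_along (V : H1 -> H1) (f : H1 -> R) (A : H1) : R :=
  Derive (fun s : R => f (plus A (scal s (V A)))) 0.

Lemma vX_flow (A : H1) (s : R) : plus A (scal s (vX A)) = hmul A (s, 0, 0).
Proof.
destruct A as [[x y] z].
apply injective_projections; [apply injective_projections|]; simpl;
  unfold plus, scal, mult; simpl; unfold mult; simpl;
  match goal with |- @eq _ ?a ?b => change (@eq R a b) end; ring.
Qed.

Lemma vY_flow (A : H1) (s : R) : plus A (scal s (vY A)) = hmul A (0, s, 0).
Proof.
destruct A as [[x y] z].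
apply injective_projections; [apply injective_projections|]; simpl;
  unfold plus, scal, mult; simpl; unfold mult; simpl;
  match goal with |- @eq _ ?a ?b => change (@eq R a b) end; ring.
Qed.

Definition homogeneous_hom (L : H1 -> R) : Prop :=
  (forall A : H1, continuous L A) /\
  (forall A B : H1, L (hmul A B) = L A + L B) /\
  (forall (t : R) (B : H1), 0 < t -> L (dil t B) = t * L B).

(* L is the horizontal differential D_h f(A). *)
Definition is_hdiff (f : H1 -> R) (A : H1) (L : H1 -> R) : Prop :=
  homogeneous_hom L /\
  is_domin (locally ((0, 0, 0) : H1)) rho_inf
    (fun B : H1 => f (hmul A B) - f A - L B).

(* Homogeneous homomorphisms form a finite-dimensional vector space, on which
   the topology is that of pointwise convergence. *)
Definition C1_H (f : H1 -> R) : Prop :=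
  exists D : H1 -> H1 -> R,
    (forall A : H1, is_hdiff f A (D A)) /\
    (forall B A : H1, continuous (fun A' : H1 => D A' B) A).

(* Partial maps are total functions of which only the values on the stated
   domain matter. *)
Definition homeomorphism_on {T V : UniformSpace} (D : T -> Prop) (E : V -> Prop)
    (F : T -> V) : Prop :=
  (forall p : T, D p -> E (F p)) /\ continuous_on D F /\
  exists G : V -> T,
    (forall q : V, E q -> D (G q)) /\ continuous_on E G /\
    (forall p : T, D p -> G (F p) = p) /\
    (forall q : V, E q -> F (G q) = q).

Definition graph_map (phi : R * R -> R) (q : R * R) : H1 :=
  hmul (0, fst q, snd q) (phi q, 0, 0).

Lemma graph_mapE (phi : R * R -> R) (y z : R) :
  graph_map phi (y, z) = (phi (y, z), y, z + 2 * phi (y, z) * y).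
Proof.
unfold graph_map; simpl.
apply injective_projections; [apply injective_projections|]; simpl; ring.
Qed.

Definition W (phi : R * R -> R) (q : R * R) : R * R := (1, - 4 * phi q).

Definition w (f : H1 -> R) (phi : R * R -> R) (q : R * R) : R :=
  - (derive_along vY f (graph_map phi q) / derive_along vX f (graph_map phi q)).

Definition open_interval (I : R -> Prop) : Prop :=
  exists a b : Rbar, forall t : R, I t <-> Rbar_lt a t /\ Rbar_lt t b.

(* Class C^k of a curve on an open set I of parameters. *)
Fixpoint class_C {V : NormedModule R_AbsRing} (k : nat) (I : R -> Prop)
    (c : R -> V) : Prop :=
  match k with
  | O => forall t : R, I t -> continuous c t
  | S k' => exists c' : R -> V,
      (forall t : R, I t -> is_derive c t (c' t)) /\ class_C k' I c'
  end.

Definition horizontal (I : R -> Prop) (c : R -> H1) : Prop :=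
  class_C 1 I c /\
  forall (t : R) (v : H1), I t -> is_derive c t v ->
    exists a b : R, v = plus (scal a (vX (c t))) (scal b (vY (c t))).

Definition cauchy_solution (Omega : R * R -> Prop) (V : R * R -> R * R)
    (q0 : R * R) (I : R -> Prop) (gamma : R -> R * R) : Prop :=
  open_interval I /\ I 0 /\ gamma 0 = q0 /\
  class_C 1 I gamma /\
  (forall t : R, I t -> Omega (gamma t)) /\
  (forall t : R, I t -> is_derive gamma t (V (gamma t))).

Definition maximal_cauchy_solution (Omega : R * R -> Prop)
    (V : R * R -> R * R) (q0 : R * R) (I : R -> Prop) (gamma : R -> R * R) : Prop :=
  cauchy_solution Omega V q0 I gamma /\
  forall (J : R -> Prop) (eta : R -> R * R),
    cauchy_solution Omega V q0 J eta ->
    (forall t : R, I t -> J t) ->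
    (forall t : R, I t -> eta t = gamma t) ->
    forall t : R, J t -> I t.

(* Main.v *)
Require Import Defs.
From Stdlib Require Import Reals Lra.
From Coquelicot Require Import Coquelicot.
Open Scope R_scope.

(** Put u = phi o gamma. The ODE z' = -4 u along gamma makes the group increment
    Phi(gamma(t))^-1 Phi(gamma(t+h)) equal to (Delta u, h, zeta) with
    zeta = 2 h Delta u - 4 int_t^(t+h) (u - u(t)), so |zeta| <= 6 |h| M where M is
    the oscillation of u around t at scale |h|. Since f vanishes on the surface,
    horizontal differentiability at the single point Phi(gamma(t)) gives
    Xf Delta u + Yf h = o(|Delta u| + |h| + sqrt(|h| M)) = o(|h| + M). As Xf <> 0,
    this forces M = O(|h|), and then Delta u = - (Yf / Xf) h + o(h). *)

Ltac coords := repeat match goal with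
  |- (_, _) = (_, _) => apply (f_equal2 pair) end.

(** * Real-variable estimates for the oscillation of [u] *)

(** The geometric mean of [h] and [M] is at most their arithmetic mean, so the square root costs
    only a linear term; the constant 3 is not sharp. *)
Lemma sqrt_gap_bound (x h M : R) :
  0 <= h -> 0 <= M -> x <= 6 * h * M -> sqrt x <= 3 * (h + M).
Proof.
intros Hh HM Hx.
rewrite <- (sqrt_pow2 (3 * (h + M))) by lra.
apply sqrt_le_1_alt; nra.
Qed.

(** The function [z s + 4 * u t * s] has derivative [- 4 * (u s - u t)], so the mean value theorem
    contributes [4 * Rabs h * M]. The remainder [2 * (u (t + h) - u t) * h] contributes the other
    [2 * Rabs h * M]. *)
Lemma vertical_gap_bound (u z : R -> R) (t h M : R) :
  (forall s, Rabs (s - t) <= Rabs h -> is_derive z s (- 4 * u s)) ->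
  (forall s, Rabs (s - t) <= Rabs h -> Rabs (u s - u t) <= M) ->
  Rabs (z (t + h) - z t + 2 * (u (t + h) + u t) * h) <= 6 * Rabs h * M.
Proof.
intros Hz HM.
destruct (MVT_abs (fun s => z s + 4 * u t * s)
  (fun s => - 4 * (u s - u t)) t (t + h)) as [c [Ec Hc]].
{ intros c Hc.
  assert (Hct : Rabs (c - t) <= Rabs h).
  { revert Hc; unfold Rmin, Rmax; destruct (Rle_dec t (t + h));
      unfold Rabs; do 2 destruct Rcase_abs; lra. }
  apply is_derive_Reals.
  generalize (Hz c Hct); intros Hd.
  evar_last.
  apply @is_derive_plus; [exact Hd|].
  apply (is_derive_scal (fun s => s) c (4 * u t)); apply @is_derive_id.
  unfold plus, one; simpl; ring. }
assert (Hct : Rabs (c - t) <= Rabs h).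
{ revert Hc; unfold Rmin, Rmax; destruct (Rle_dec t (t + h));
    unfold Rabs; do 2 destruct Rcase_abs; lra. }
assert (Hth : Rabs (t + h - t) <= Rabs h)
  by (replace (t + h - t) with h by ring; lra).
assert (Mc := HM c Hct).
assert (Mh := HM _ Hth).
replace (t + h - t) with h in Ec by ring.
replace (z (t + h) - z t + 2 * (u (t + h) + u t) * h) with
  ((z (t + h) + 4 * u t * (t + h) - (z t + 4 * u t * t))
   + 2 * (u (t + h) - u t) * h) by ring.
eapply Rle_trans; [apply Rabs_triang|].
rewrite Ec, !Rabs_mult.
rewrite (Rabs_left (-4)), (Rabs_pos_eq 2) by lra.
generalize (Rabs_pos h); nra.
Qed.

(* With M the maximal oscillation of u on [t - |h|, t + |h|],
   applying the estimate at a maximum point first yields M = O(h), and only then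
   can the square root be absorbed into o(h). *)
Lemma is_derive_of_balance (a b : R) (u z : R -> R) (t d0 : R) :
  a <> 0 -> 0 < d0 ->
  (forall s, Rabs (s - t) < d0 -> continuous u s) ->
  (forall s, Rabs (s - t) < d0 -> is_derive z s (- 4 * u s)) ->
  (forall eps, 0 < eps -> exists d, 0 < d /\ forall h, Rabs h < d ->
     Rabs (a * (u (t + h) - u t) + b * h) <=
     eps * (Rabs (u (t + h) - u t) + Rabs h
       + sqrt (Rabs (z (t + h) - z t + 2 * (u (t + h) + u t) * h)))) ->
  is_derive u t (- (b / a)).
Proof.
intros Ha Hd0 Hu Hz Hbal.
assert (Ha' : 0 < Rabs a) by now apply Rabs_pos_lt.
(* Compactness gives a maximum point [t + s0] of the oscillation, at which the balance can be
   evaluated. *)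
assert (Hmax : forall h, Rabs h < d0 -> exists s0, Rabs s0 <= Rabs h /\
  forall s, Rabs (s - t) <= Rabs h -> Rabs (u s - u t) <= Rabs (u (t + s0) - u t)).
{ intros h Hh.
  destruct (continuity_ab_maj (fun s => Rabs (u s - u t)) (t - Rabs h) (t + Rabs h))
    as [m [Hm1 Hm2]].
  - generalize (Rabs_pos h); lra.
  - intros c Hc.
    apply continuity_pt_filterlim.
    apply (continuous_comp (fun s => u s - u t) Rabs).
    + apply (@continuous_minus R_UniformSpace R_AbsRing R_NormedModule).
      * apply Hu. apply Rle_lt_trans with (Rabs h); [|exact Hh].
        apply Rabs_le; lra.
      * apply continuous_const.
    + apply continuous_Rabs.
  - exists (m - t); split.
    + apply Rabs_le; lra.
    + intros s Hs. replace (t + (m - t)) with m by ring.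
      apply Hm1. apply Rabs_le_between in Hs; lra. }
(* The factor 4 adds the linear terms, at most [Rabs h + M], to the bound [3 * (Rabs h + M)] for the
   square root. *)
assert (Hest : forall eps, 0 < eps -> exists d, 0 < d /\ d <= d0 /\
  forall h s0, Rabs h < d -> Rabs s0 <= Rabs h ->
  (forall s, Rabs (s - t) <= Rabs h -> Rabs (u s - u t) <= Rabs (u (t + s0) - u t)) ->
  forall s, Rabs s <= Rabs h -> Rabs (a * (u (t + s) - u t) + b * s) <=
    4 * eps * (Rabs h + Rabs (u (t + s0) - u t))).
{ intros eps Heps.
  destruct (Hbal eps Heps) as [d [Hd H]].
  exists (Rmin d d0); split; [now apply Rmin_glb_lt|split; [apply Rmin_r|]].
  intros h s0 Hh Hs0 HM s Hs.
  assert (h1 := Rmin_l d d0); assert (h2 := Rmin_r d d0).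
  eapply Rle_trans; [apply H; lra|].
  set (M := Rabs (u (t + s0) - u t)) in *.
  assert (HM0 : 0 <= M) by apply Rabs_pos.
  assert (Hgap := vertical_gap_bound u z t s M).
  assert (Hus : Rabs (u (t + s) - u t) <= M).
  { apply HM; now replace (t + s - t) with s by ring. }
  assert (Hsq : sqrt (Rabs (z (t + s) - z t + 2 * (u (t + s) + u t) * s))
    <= 3 * (Rabs s + M)).
  { apply sqrt_gap_bound; [apply Rabs_pos|exact HM0|].
    apply Hgap; intros r Hr; [apply Hz|apply HM]; lra. }
  replace (4 * eps * (Rabs h + M)) with (eps * (4 * (Rabs h + M))) by ring.
  apply Rmult_le_compat_l; lra. }
(* With this choice the error is [Rabs a / 2 * (Rabs h + M)]. Half of [Rabs a * M] is then absorbed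
   on the left, which leaves exactly the constant [K] below. *)
destruct (Hest (Rabs a / 8) ltac:(lra)) as [d1 [Hd1 [_ Hest1]]].
set (K := 1 + 2 * (Rabs b / Rabs a)).
assert (HK : 1 <= K).
{ unfold K; assert (0 <= Rabs b / Rabs a); [|lra].
  apply Rdiv_le_0_compat; [apply Rabs_pos|exact Ha']. }
assert (Hlip : forall h s0, Rabs h < d1 -> Rabs s0 <= Rabs h ->
  (forall s, Rabs (s - t) <= Rabs h -> Rabs (u s - u t) <= Rabs (u (t + s0) - u t)) ->
  Rabs (u (t + s0) - u t) <= K * Rabs h).
{ intros h s0 Hh Hs0 HM.
  (* At the displacement [s0] the increment of [u] has absolute value [M], so the estimate bounds
     [M] in terms of itself. *)
  assert (E := Hest1 h s0 Hh Hs0 HM s0 Hs0).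
  set (M := Rabs (u (t + s0) - u t)) in *.
  assert (F : Rabs a * M <= Rabs (a * (u (t + s0) - u t) + b * s0) + Rabs b * Rabs h).
  { unfold M; rewrite <- Rabs_mult.
    replace (a * (u (t + s0) - u t)) with
      ((a * (u (t + s0) - u t) + b * s0) + - (b * s0)) at 1 by ring.
    eapply Rle_trans; [apply Rabs_triang|].
    apply Rplus_le_compat_l. rewrite Rabs_Ropp, Rabs_mult.
    apply Rmult_le_compat_l; [apply Rabs_pos|exact Hs0]. }
  apply Rmult_le_reg_l with (Rabs a); [exact Ha'|].
  replace (Rabs a * (K * Rabs h)) with (Rabs a * Rabs h + 2 * (Rabs b * Rabs h))
    by (unfold K; field; lra).
  lra. }
apply is_derive_Reals; intros eps Heps.
(* Once [M <= K * Rabs h], the error becomes [Rabs a * eps / 2 * Rabs h], and division by [a * h]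
   leaves [eps / 2]. *)
destruct (Hest (Rabs a * eps / (8 * (1 + K)))) as [d2 [Hd2 [Hd20 Hest2]]].
{ apply Rdiv_lt_0_compat; [now apply Rmult_lt_0_compat|lra]. }
assert (Hd : 0 < Rmin d1 d2) by now apply Rmin_glb_lt.
exists (mkposreal _ Hd); simpl; intros h Hh0 Hh.
assert (h1 := Rmin_l d1 d2); assert (h2 := Rmin_r d1 d2).
destruct (Hmax h ltac:(lra)) as [s0 [Hs0 HM]].
assert (L := Hlip h s0 ltac:(lra) Hs0 HM).
assert (E := Hest2 h s0 ltac:(lra) Hs0 HM h (Rle_refl _)).
assert (Hh' : 0 < Rabs h) by now apply Rabs_pos_lt.
replace ((u (t + h) - u t) / h - - (b / a)) with
  ((a * (u (t + h) - u t) + b * h) / (a * h)) by (field; now split).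
rewrite Rabs_div by (now apply Rmult_integral_contrapositive).
rewrite Rabs_mult.
apply Rle_lt_trans with (eps / 2); [|lra].
apply Rle_div_l; [now apply Rmult_lt_0_compat|].
eapply Rle_trans; [exact E|].
apply Rle_trans with
  (4 * (Rabs a * eps / (8 * (1 + K))) * (Rabs h + K * Rabs h)).
- apply Rmult_le_compat_l; [|lra].
  apply Rmult_le_pos; [lra|]. apply Rdiv_le_0_compat; nra.
- right; field; lra.
Qed.

(** * The horizontal differential in coordinates *)

(** Vertical elements are differences of products taken in opposite orders, so a homomorphism into
    the commutative group of reals kills them. On horizontal elements homogeneity gives the rest. *)
Lemma hom_coordinates (L : H1 -> R) (x y z : R) :
  homogeneous_hom L -> L (x, y, z) = x * L (1, 0, 0) + y * L (0, 1, 0).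
Proof.
intros [_ [Hadd Hdil]].
assert (E0 : L (0, 0, 0) = 0).
{ generalize (Hadd (0, 0, 0) (0, 0, 0)); simpl.
  replace (0, 0 + 0, 0 + 0 + 2 * 0 * 0 - 2 * 0 * 0) with (0, 0, 0) by (coords; ring).
  replace (0 + 0, 0 + 0, 0 + 0 + 2 * 0 * 0 - 2 * 0 * 0) with (0, 0, 0) by (coords; ring).
  lra. }
(* [Hdil] covers positive factors only; negative ones are reached through the inverse, which changes
   the sign of all coordinates. *)
assert (Hlin : forall p q k, L (k * p, k * q, 0) = k * L (p, q, 0)).
{ assert (Hpos : forall p q k, 0 < k -> L (k * p, k * q, 0) = k * L (p, q, 0)).
  { intros p q k Hk; rewrite <- (Hdil k (p, q, 0) Hk); simpl; f_equal; coords; ring. }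
  intros p q k.
  destruct (Rtotal_order k 0) as [Hk|[->|Hk]].
  - assert (Hopp : L (k * p, k * q, 0) + L (- k * p, - k * q, 0) = 0).
    { rewrite <- Hadd; transitivity (L (0, 0, 0)); [simpl; f_equal; coords; ring|exact E0]. }
    rewrite (Hpos p q (- k)) in Hopp by lra. lra.
  - replace (0 * p, 0 * q, 0) with (0, 0, 0) by (coords; ring). lra.
  - now apply Hpos. }
assert (Hcomm : L (0, 0, (z + 2 * x * y)) = 0).
{ (* (0, 0, c) is the commutator of (1, 0, 0) and (0, - c / 4, 0) *)
  set (c := z + 2 * x * y).
  generalize (Hadd (1, - c / 4, - c / 2) (0, 0, c)), (Hadd (1, 0, 0) (0, - c / 4, 0)),
    (Hadd (0, - c / 4, 0) (1, 0, 0)); simpl.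
  replace (1 + 0, - c / 4 + 0, - c / 2 + c + 2 * 0 * (- c / 4) - 2 * 1 * 0)
    with (1, - c / 4, c / 2) by (coords; field).
  replace (1 + 0, 0 + - c / 4, 0 + 0 + 2 * 0 * 0 - 2 * 1 * (- c / 4))
    with (1, - c / 4, c / 2) by (coords; field).
  replace (0 + 1, - c / 4 + 0, 0 + 0 + 2 * 1 * (- c / 4) - 2 * 0 * 0)
    with (1, - c / 4, - c / 2) by (coords; field).
  lra. }
(* The product of [(x, 0, 0)] and [(0, y, 0)] has vertical entry [- 2 * x * y], which the last
   factor corrects. Entries such as [x * 1] and [x * 0] are in the shape that [Hlin] rewrites. *)
replace (x, y, z) with
  (hmul (hmul (x * 1, x * 0, 0) (y * 0, y * 1, 0)) (0, 0, z + 2 * x * y))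
  by (simpl; coords; ring).
rewrite !Hadd, !Hlin, Hcomm; ring.
Qed.

Lemma rho_inf_le (x y z : R) :
  rho_inf (x, y, z) <= Rabs x + Rabs y + sqrt (Rabs z).
Proof.
unfold rho_inf.
assert (Hx := Rabs_pos x); assert (Hy := Rabs_pos y); assert (Hz := sqrt_pos (Rabs z)).
apply Rmax_lub; [|lra].
apply Rle_trans with (Rabs x + Rabs y); [|lra].
rewrite <- (sqrt_pow2 (Rabs x + Rabs y)) by lra.
apply sqrt_le_1_alt.
rewrite <- (pow2_abs x), <- (pow2_abs y); nra.
Qed.

(** Balls of the product are boxes, so smallness can be asked of each coordinate separately;
    [rho_inf_le] replaces the gauge by a sum. *)
Lemma hdiff_estimate (f : H1 -> R) (A : H1) (L : H1 -> R) (eps : R) :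
  is_hdiff f A L -> 0 < eps ->
  exists d, 0 < d /\ forall x y z, Rabs x < d -> Rabs y < d -> Rabs z < d ->
    Rabs (f (hmul A (x, y, z)) - f A - (x * L (1, 0, 0) + y * L (0, 1, 0)))
      <= eps * (Rabs x + Rabs y + sqrt (Rabs z)).
Proof.
intros [HL Hdom] Heps.
destruct (Hdom (mkposreal _ Heps)) as [d Hd].
exists d; split; [apply cond_pos|]; intros x y z Hx Hy Hz.
rewrite <- (hom_coordinates L x y z HL).
assert (Hb : ball ((0, 0, 0) : H1) d (x, y, z)).
{ repeat split; simpl; unfold ball; simpl; unfold AbsRing_ball, abs, minus, plus, opp; simpl;
  rewrite Ropp_0, Rplus_0_r; assumption. }
generalize (Hd _ Hb); change (@norm _ R_NormedModule) with Rabs; simpl.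
intros E; eapply Rle_trans; [exact E|].
apply Rmult_le_compat_l; [lra|].
rewrite Rabs_pos_eq; [apply rho_inf_le|].
eapply Rle_trans; [|apply Rmax_l]; apply sqrt_pos.
Qed.

(** On increments [(h, 0, 0)], the flow of [vX], the intrinsic expansion is an ordinary first-order
    expansion in [h]. Taking [eps / 2] turns its weak inequality into a strict one. *)
Lemma derive_along_hdiff_X (f : H1 -> R) (A : H1) (L : H1 -> R) :
  is_hdiff f A L -> derive_along vX f A = L (1, 0, 0).
Proof.
intros Hf; unfold derive_along; apply is_derive_unique, is_derive_Reals.
intros eps Heps.
destruct (hdiff_estimate f A L (eps / 2) Hf ltac:(lra)) as [d [Hd H]].
exists (mkposreal _ Hd); simpl; intros h Hh0 Hh.
assert (E := H h 0 0 Hh ltac:(now rewrite Rabs_R0) ltac:(now rewrite Rabs_R0)).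
rewrite Rplus_0_l, !vX_flow.
replace (hmul A (0, 0, 0)) with A
  by (destruct A as [[x y] z]; simpl; coords; ring).
rewrite Rabs_R0, sqrt_0, !Rplus_0_r, Rmult_0_l, Rplus_0_r in E.
replace ((f (hmul A (h, 0, 0)) - f A) / h - L (1, 0, 0)) with
  ((f (hmul A (h, 0, 0)) - f A - h * L (1, 0, 0)) / h) by (field; exact Hh0).
rewrite Rabs_div by exact Hh0.
apply Rle_lt_trans with (eps / 2); [|lra].
apply Rle_div_l; [now apply Rabs_pos_lt|exact E].
Qed.

Lemma derive_along_hdiff_Y (f : H1 -> R) (A : H1) (L : H1 -> R) :
  is_hdiff f A L -> derive_along vY f A = L (0, 1, 0).
Proof.
intros Hf; unfold derive_along; apply is_derive_unique, is_derive_Reals.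
intros eps Heps.
destruct (hdiff_estimate f A L (eps / 2) Hf ltac:(lra)) as [d [Hd H]].
exists (mkposreal _ Hd); simpl; intros h Hh0 Hh.
assert (E := H 0 h 0 ltac:(now rewrite Rabs_R0) Hh ltac:(now rewrite Rabs_R0)).
rewrite Rplus_0_l, !vY_flow.
replace (hmul A (0, 0, 0)) with A
  by (destruct A as [[x y] z]; simpl; coords; ring).
rewrite Rabs_R0, sqrt_0, Rplus_0_r, Rplus_0_l, Rmult_0_l, Rplus_0_l in E.
replace ((f (hmul A (0, h, 0)) - f A) / h - L (0, 1, 0)) with
  ((f (hmul A (0, h, 0)) - f A - h * L (0, 1, 0)) / h) by (field; exact Hh0).
rewrite Rabs_div by exact Hh0.
apply Rle_lt_trans with (eps / 2); [|lra].
apply Rle_div_l; [now apply Rabs_pos_lt|exact E].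
Qed.

(** * Calculus of curves, coordinate by coordinate *)

Lemma is_derive_pair {V1 V2 : NormedModule R_AbsRing} (u : R -> V1) (v : R -> V2)
    (t : R) (du : V1) (dv : V2) :
  is_derive u t du -> is_derive v t dv ->
  is_derive (fun s => (u s, v s)) t (du, dv).
Proof.
intros Hu Hv.
apply (filterdiff_comp'_2 u v (fun a b => (a, b)) t
  (fun s => scal s du) (fun s => scal s dv) (fun a b => (a, b)) Hu Hv).
apply filterdiff_ext with (fun p : prod_NormedModule R_AbsRing V1 V2 => p);
  [now intros []|].
apply filterdiff_ext_lin with (fun p : prod_NormedModule R_AbsRing V1 V2 => p);
  [apply filterdiff_id|now intros []].
Qed.

Lemma is_derive_fst {V1 V2 : NormedModule R_AbsRing} (c : R -> V1 * V2) (t : R)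
    (v : V1 * V2) :
  is_derive c t v -> is_derive (fun s => fst (c s)) t (fst v).
Proof.
intros Hc.
apply (filterdiff_comp' c fst t (fun s => scal s v) fst Hc).
apply filterdiff_linear, is_linear_fst.
Qed.

Lemma is_derive_snd {V1 V2 : NormedModule R_AbsRing} (c : R -> V1 * V2) (t : R)
    (v : V1 * V2) :
  is_derive c t v -> is_derive (fun s => snd (c s)) t (snd v).
Proof.
intros Hc.
apply (filterdiff_comp' c snd t (fun s => scal s v) snd Hc).
apply filterdiff_linear, is_linear_snd.
Qed.

Lemma continuous_pair {T V1 V2 : UniformSpace} (u : T -> V1) (v : T -> V2) (t : T) :
  continuous u t -> continuous v t -> continuous (fun s => (u s, v s)) t.
Proof.
intros Hu Hv P [eps HP].
change (locally t (fun s => P (u s, v s))).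
apply filter_imp with (fun s => ball (u t) eps (u s) /\ ball (v t) eps (v s)).
- intros s [Hs1 Hs2]; apply HP; now split.
- apply filter_and; [apply (Hu (ball (u t) eps))|apply (Hv (ball (v t) eps))];
    apply locally_ball.
Qed.

Lemma open_interval_ball (I : R -> Prop) (t : R) :
  Defs.open_interval I -> I t ->
  exists d, 0 < d /\ forall s, Rabs (s - t) < d -> I s.
Proof.
intros [a [b HI]] Ht.
assert (Hopen : open (fun s : R => Rbar_lt a s /\ Rbar_lt s b))
  by (apply open_and; [apply open_Rbar_gt|apply open_Rbar_lt]).
destruct (Hopen t (proj1 (HI t) Ht)) as [d Hd].
exists d; split; [apply cond_pos|]; intros s Hs.
apply HI, Hd, Hs.
Qed.

(** [horizontal] quantifies over every derivative of the curve; uniqueness reduces the check to one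
    computed velocity. *)
Lemma is_derive_prod_unique (c : R -> H1) (t : R) (v v' : H1) :
  is_derive c t v -> is_derive c t v' -> v = v'.
Proof.
assert (HR : forall (g : R -> R) l l', is_derive g t l -> is_derive g t l' -> l = l').
{ intros g l l' Hl Hl'.
  now rewrite <- (is_derive_unique g t l Hl), <- (is_derive_unique g t l' Hl'). }
intros Hv Hv'.
destruct v as [[v1 v2] v3]; destruct v' as [[w1 w2] w3]; coords.
- exact (HR _ _ _ (is_derive_fst _ _ _ (is_derive_fst _ _ _ Hv))
    (is_derive_fst _ _ _ (is_derive_fst _ _ _ Hv'))).
- exact (HR _ _ _ (is_derive_snd _ _ _ (is_derive_fst _ _ _ Hv))
    (is_derive_snd _ _ _ (is_derive_fst _ _ _ Hv'))).
- exact (HR _ _ _ (is_derive_snd _ _ _ Hv) (is_derive_snd _ _ _ Hv')).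
Qed.

(** * Differentiating [phi] along a solution *)

(** The second factor is the group increment between two points of the graph; its vertical entry is
    the quantity bounded by [vertical_gap_bound]. *)
Lemma hmul_graph_increment (phi : R * R -> R) (p q : R * R) (h : R) :
  fst q = fst p + h ->
  hmul (graph_map phi p)
    (phi q - phi p, h, snd q - snd p + 2 * (phi q + phi p) * h) = graph_map phi q.
Proof.
destruct p as [y z], q as [y' z']; simpl; intros ->.
rewrite !graph_mapE; simpl; coords; ring.
Qed.

Lemma is_derive_phi_along (f : H1 -> R) (phi : R * R -> R) (gamma : R -> R * R)
    (t d : R) (L : H1 -> R) :
  0 < d ->
  (forall s, Rabs (s - t) < d -> continuous (fun r => phi (gamma r)) s) ->
  (forall s, Rabs (s - t) < d -> is_derive gamma s (W phi (gamma s))) ->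
  (forall s, Rabs (s - t) < d -> f (graph_map phi (gamma s)) = 0) ->
  is_hdiff f (graph_map phi (gamma t)) L -> L (1, 0, 0) <> 0 ->
  is_derive (fun s => phi (gamma s)) t (- (L (0, 1, 0) / L (1, 0, 0))).
Proof.
intros Hd Hphi Hgam Hf HL HX.
assert (Hz : forall s, Rabs (s - t) < d ->
  is_derive (fun r => snd (gamma r)) s (- 4 * phi (gamma s)))
  by (intros s Hs; exact (is_derive_snd _ _ _ (Hgam s Hs))).
(* The first component of [W] is 1, so [fst (gamma s) - s] has zero derivative and is constant. *)
assert (Hy : forall h, Rabs h < d -> fst (gamma (t + h)) = fst (gamma t) + h).
{ intros h Hh.
  destruct (MVT_abs (fun s => fst (gamma s) - s) (fun _ => 0) t (t + h))
    as [c [Ec _]].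
  - intros c Hc; apply is_derive_Reals.
    assert (Hct : Rabs (c - t) < d).
    { revert Hc Hh; unfold Rmin, Rmax; destruct (Rle_dec t (t + h));
        unfold Rabs; do 2 destruct Rcase_abs; lra. }
    evar_last.
    + apply @is_derive_minus;
        [exact (is_derive_fst _ _ _ (Hgam c Hct))|apply @is_derive_id].
    + unfold minus, plus, opp, one; simpl; ring.
  - rewrite Rabs_R0, Rmult_0_l in Ec.
    destruct (Req_dec (fst (gamma (t + h)) - (t + h) - (fst (gamma t) - t)) 0)
      as [E|E]; [lra|now apply Rabs_no_R0 in E]. }
apply (is_derive_of_balance (L (1, 0, 0)) (L (0, 1, 0)) (fun s => phi (gamma s))
  (fun s => snd (gamma s)) t d HX Hd Hphi Hz).
intros eps Heps.
destruct (hdiff_estimate f _ L eps HL Heps) as [e [He H]].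
assert (Ht : Rabs (t - t) < d) by (now rewrite Rminus_diag, Rabs_R0).
assert (Cu := Hphi t Ht).
assert (Cz : continuous (fun r => snd (gamma r)) t)
  by (apply (ex_derive_continuous (fun r => snd (gamma r))); eexists; apply (Hz t Ht)).
apply continuity_pt_filterlim in Cu; apply continuity_pt_filterlim in Cz.
(* The vertical entry of the increment vanishes at [s = t]; continuity keeps it inside the box of
   [hdiff_estimate]. *)
assert (Czeta : continuity_pt
  (fun s => snd (gamma s) - snd (gamma t) + 2 * (phi (gamma s) + phi (gamma t)) * (s - t)) t).
{ apply (continuity_pt_plus (fun s => snd (gamma s) - snd (gamma t))
    (fun s => 2 * (phi (gamma s) + phi (gamma t)) * (s - t))).
  - apply (continuity_pt_minus _ (fun _ => snd (gamma t))); [exact Cz|].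
    now apply continuity_pt_const.
  - apply (continuity_pt_mult (fun s => 2 * (phi (gamma s) + phi (gamma t))) (fun s => s - t)).
    + apply (continuity_pt_scal (fun s => phi (gamma s) + phi (gamma t))).
      apply (continuity_pt_plus _ (fun _ => phi (gamma t))); [exact Cu|].
      now apply continuity_pt_const.
    + apply (continuity_pt_minus id (fun _ => t)); [apply continuity_pt_id|].
      now apply continuity_pt_const. }
apply continuity_pt_locally with (eps := mkposreal e He) in Cu.
apply continuity_pt_locally with (eps := mkposreal e He) in Czeta.
destruct Cu as [d1 Hd1]; destruct Czeta as [d2 Hd2]; simpl in Hd1, Hd2.
exists (Rmin (Rmin d e) (Rmin d1 d2)); split.
{ repeat apply Rmin_glb_lt; trivial; apply cond_pos. }
intros h Hh.
assert (l1 := Rmin_l (Rmin d e) (Rmin d1 d2)); assert (l2 := Rmin_r (Rmin d e) (Rmin d1 d2)).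
assert (l3 := Rmin_l d e); assert (l4 := Rmin_r d e).
assert (l5 := Rmin_l d1 d2); assert (l6 := Rmin_r d1 d2).
assert (Hth : t + h - t = h) by ring.
assert (B : forall r : posreal, Rabs h < r -> ball t r (t + h)).
{ intros r Hr; unfold ball; simpl; unfold AbsRing_ball, abs, minus, plus, opp; simpl.
  now replace (t + h + - t) with h by ring. }
assert (E1 := Hd1 (t + h) (B d1 ltac:(lra))).
assert (E2 := Hd2 (t + h) (B d2 ltac:(lra))).
rewrite Hth, !Rminus_diag, Rmult_0_r, Rplus_0_r, Rminus_0_r in E2.
assert (E := H _ h _ E1 ltac:(lra) E2).
rewrite hmul_graph_increment in E by (apply Hy; lra).
(* Both endpoints lie in the zero set of [f], so only the linear part of the expansion survives. *)
rewrite !Hf in E by (rewrite ?Hth; lra).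
rewrite Rminus_0_r, Rminus_0_l, Rabs_Ropp in E.
now rewrite (Rmult_comm (L _)), (Rmult_comm (L (0, 1, 0))).
Qed.

Theorem mainTheorem6 (f : H1 -> R) (U : H1 -> Prop)
    (Omega : R * R -> Prop) (phi : R * R -> R)
    (hf : C1_H f)
    (hf0 : f (0, 0, 0) = 0)
    (hXf0 : derive_along vX f (0, 0, 0) <> 0)
    (hU : locally ((0, 0, 0) : H1) U)
    (hXfU : forall A : H1, U A -> derive_along vX f A <> 0)
    (hOmega : open Omega)
    (hphi : continuous_on Omega phi)
    (hS : forall A : H1,
      (f A = 0 /\ U A) <-> exists q : R * R, Omega q /\ A = graph_map phi q)
    (hPhi : homeomorphism_on Omega (fun A : H1 => f A = 0 /\ U A) (graph_map phi))
    (y0 z0 : R) (h0 : Omega (y0, z0))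
    (I : R -> Prop) (gamma : R -> R * R)
    (hgamma : maximal_cauchy_solution Omega (W phi) (y0, z0) I gamma) :
  class_C 2 I gamma /\
  class_C 1 I (fun t : R => phi (gamma t)) /\
  horizontal I (fun t : R => graph_map phi (gamma t)) /\
  (forall t : R, I t -> f (graph_map phi (gamma t)) = 0 /\ U (graph_map phi (gamma t))) /\
  (forall t : R, I t ->
    is_derive (fun s : R => phi (gamma s)) t (w f phi (gamma t)) /\
    is_derive (fun s : R => graph_map phi (gamma s)) t
      (let P := graph_map phi (gamma t) in
       plus (scal (- (derive_along vY f P / derive_along vX f P)) (vX P)) (vY P))).
Proof.
destruct hf as [D [hD hDcont]].
destruct hgamma as [[HI [_ [_ [_ [HOm Hgam]]]]] _].
assert (HS : forall t, I t ->
  f (graph_map phi (gamma t)) = 0 /\ U (graph_map phi (gamma t))).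
{ intros t Ht; apply hS; exists (gamma t); split; [now apply HOm|reflexivity]. }
assert (HX : forall A, derive_along vX f A = D A (1, 0, 0))
  by (intros A; now apply derive_along_hdiff_X).
assert (HY : forall A, derive_along vY f A = D A (0, 1, 0))
  by (intros A; now apply derive_along_hdiff_Y).
assert (HX0 : forall t, I t -> D (graph_map phi (gamma t)) (1, 0, 0) <> 0)
  by (intros t Ht; rewrite <- HX; now apply hXfU, HS).
assert (Cgam : forall t, I t -> continuous gamma t).
{ intros t Ht; apply (ex_derive_continuous gamma); eexists; now apply Hgam. }
assert (Cphi : forall t, I t -> continuous (fun s => phi (gamma s)) t).
{ intros t Ht; apply (continuous_comp gamma phi); [now apply Cgam|].
  (* Openness of [Omega] upgrades relative continuity to continuity at the point. *)
  apply continuous_continuous_on with Omega; [apply hOmega; now apply HOm|exact hphi]. }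
assert (Dphi : forall t, I t -> is_derive (fun s => phi (gamma s)) t (w f phi (gamma t))).
{ intros t Ht; unfold w; rewrite HX, HY.
  destruct (open_interval_ball I t HI Ht) as [d [Hd HId]].
  apply (is_derive_phi_along f phi gamma t d (D (graph_map phi (gamma t))));
    auto; intros s Hs; now apply HS, HId. }
assert (Dy : forall t, I t -> is_derive (fun s => fst (gamma s)) t 1)
  by (intros t Ht; exact (is_derive_fst _ _ _ (Hgam t Ht))).
assert (Dz : forall t, I t -> is_derive (fun s => snd (gamma s)) t (- 4 * phi (gamma t)))
  by (intros t Ht; exact (is_derive_snd _ _ _ (Hgam t Ht))).
(* With [y = fst (gamma t)], the product rule gives the vertical entry
   [- 4 * phi + 2 * (w * y + phi)]; its simplified form is that of [w X + Y]. *)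
set (vel := fun t => (w f phi (gamma t), 1,
  2 * fst (gamma t) * w f phi (gamma t) - 2 * phi (gamma t)) : H1).
assert (Evel : forall t, vel t = plus (scal (w f phi (gamma t)) (vX (graph_map phi (gamma t))))
  (vY (graph_map phi (gamma t)))).
{ intros t; unfold vel, graph_map.
  apply injective_projections; [apply injective_projections|]; simpl;
    unfold plus, scal, mult; simpl; unfold mult; simpl;
    match goal with |- @eq _ ?a ?b => change (@eq R a b) end; ring. }
assert (DPhi : forall t, I t -> is_derive (fun s => graph_map phi (gamma s)) t (vel t)).
{ intros t Ht.
  apply is_derive_ext with (fun s => (phi (gamma s), fst (gamma s),
    snd (gamma s) + 2 * (phi (gamma s) * fst (gamma s)))).
  { intros s; unfold graph_map; simpl.
    coords; match goal with |- @eq _ ?a ?b => change (@eq R a b) end; ring. }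
  apply is_derive_pair; [apply is_derive_pair; auto|].
  evar_last.
  - apply @is_derive_plus; [now apply Dz|].
    apply (is_derive_scal (fun s => phi (gamma s) * fst (gamma s)) t 2).
    apply @is_derive_mult; [now apply Dphi|now apply Dy|intros; apply Rmult_comm].
  - unfold plus, mult; simpl; ring. }
assert (CPhi : forall t, I t -> continuous (fun s => graph_map phi (gamma s)) t).
{ intros t Ht; apply (ex_derive_continuous (fun s => graph_map phi (gamma s)));
    eexists; now apply DPhi. }
(* Along the lifted curve [w] is a quotient of two values of the differential at fixed vectors, each
   continuous in the base point, with nonzero denominator. *)
assert (Cw : forall t, I t -> continuous (fun s => w f phi (gamma s)) t).
{ intros t Ht.
  apply continuous_ext with (fun s => - (D (graph_map phi (gamma s)) (0, 1, 0)
    * / D (graph_map phi (gamma s)) (1, 0, 0))).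
  { intros s; unfold w; now rewrite HX, HY. }
  apply (@continuous_opp R_UniformSpace R_AbsRing R_NormedModule).
  apply (@continuous_mult R_UniformSpace R_AbsRing).
  - apply (continuous_comp (fun s => graph_map phi (gamma s)) (fun A => D A (0, 1, 0)));
      [now apply CPhi|apply hDcont].
  - apply continuous_comp with (g := Rinv); [|now apply continuous_Rinv, HX0].
    apply (continuous_comp (fun s => graph_map phi (gamma s)) (fun A => D A (1, 0, 0)));
      [now apply CPhi|apply hDcont]. }
split; [|split; [|split; [|split; [exact HS|]]]].
(* The velocity [(1, - 4 * phi)] inherits a continuous derivative from [phi] along [gamma]. *)
- exists (fun t => W phi (gamma t)); split; [exact Hgam|].
  exists (fun t => (0, - 4 * w f phi (gamma t))); split.
  + intros t Ht; unfold W; apply is_derive_pair; [apply @is_derive_const|].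
    apply is_derive_scal; now apply Dphi.
  + intros t Ht; apply continuous_pair; [apply continuous_const|].
    now apply (@continuous_scal_r R_UniformSpace R_AbsRing R_NormedModule (-4) (fun s => w f phi (gamma s))), Cw.
- exists (fun t => w f phi (gamma t)); now split.
- split.
  + exists vel; split; [exact DPhi|].
    intros t Ht.
    apply (@continuous_pair R_UniformSpace (prod_UniformSpace R_UniformSpace R_UniformSpace)
      R_UniformSpace (fun s => (w f phi (gamma s), 1))).
    { apply (@continuous_pair R_UniformSpace R_UniformSpace R_UniformSpace
        (fun s => w f phi (gamma s)) (fun _ => 1)); [now apply Cw|apply continuous_const]. }
    apply (@continuous_minus R_UniformSpace R_AbsRing R_NormedModule).
    * apply (@continuous_mult R_UniformSpace R_AbsRing); [|now apply Cw].
      apply (@continuous_scal_r R_UniformSpace R_AbsRing R_NormedModule).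
      apply (ex_derive_continuous (fun s => fst (gamma s))); eexists; now apply Dy.
    * apply (@continuous_scal_r R_UniformSpace R_AbsRing R_NormedModule); now apply Cphi.
  + intros t v Ht Hv; exists (w f phi (gamma t)), 1.
    rewrite (is_derive_prod_unique _ t v (vel t) Hv (DPhi t Ht)), Evel.
    f_equal; symmetry; apply (@scal_one R_AbsRing).
- intros t Ht; split; [now apply Dphi|].
  cbv zeta; fold (w f phi (gamma t)); rewrite <- Evel; now apply DPhi.
Qed.
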